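(* Let $C$ be a Cantor set with a regular ultrametric $d$. For every choice function $\tau\in\Upsilon(C)$, $(\mathcal{C}_{\mathrm{Lip}}(C),\mathcal H,D,\Gamma)$, with $\mathcal{C}_{\mathrm{Lip}}(C)$ represented on $\mathcal H$ by $\pi_\tau$, is an even spectral triple.
   Context: A Cantor set is a (nonempty) totally disconnected compact metrizable space without isolated points. A metric $d$ on $C$ is regular if it induces the topology of $C$, and it is an ultrametric if $d(x,y)\le\max\{d(x,z),d(z,y)\}$ for all $x,y,z$. Let $\mathcal{V}$ be the vertex set of the reduced weighted rooted tree (Michon tree) of $(C,d)$: the vertices correspond to the distinct subsets of $C$ of the form $\{y: d(x,y)<\epsilon\}$ ($x\in C$, $\epsilon>0$); the root is $C$; the children of a vertex are the maximal vertices strictly contained in it. For $v\in\mathcal V$, $[v]\subset C$ denotes the corresponding subset; it is clopen with $\mathrm{diam}[v]>0$, and $\mathcal V$ is countable. A choice function is a map $\tau:\mathcal V\to C\times C$, $\tau(v)=(\tau_+(v),\tau_-(v))$, with $\tau_\pm(v)\in[v]$ and $d(\tau_+(v),\tau_-(v))=\mathrm{diam}[v]$ for all $v$. $\Upsilon(C)$ is the set of choice functions. $\mathcal{C}_{\mathrm{Lip}}(C)$ is the $*$-algebra of complex-valued Lipschitz functions on $(C,d)$. $\mathcal H=\ell^2(\mathcal V)\otimes\mathbb C^2$, viewed as square-summable functions $\psi:\mathcal V\to\mathbb C^2$. $(D\psi)(v)=(\mathrm{diam}[v])^{-1}\sigma_1\psi(v)$ (natural maximal domain), $\sigma_1=\begin{pmatrix}0&1\\1&0\end{pmatrix}$;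 $\Gamma=\mathbf 1\otimes\sigma_3$, $\sigma_3=\mathrm{diag}\{+1,-1\}$; $(\pi_\tau(f)\psi)(v)=\mathrm{diag}\{f(\tau_+(v)),f(\tau_-(v))\}\psi(v)$. An odd spectral triple for an involutive algebra $\mathcal A$ is $(\mathcal A,\mathcal H,D)$ with $\mathcal H$ a Hilbert space on which $\mathcal A$ has a representation $\pi$ by bounded operators and $D$ a self-adjoint operator on $\mathcal H$ such that $[D,\pi(a)]$ is a bounded operator for all $a\in\mathcal A$ and $(D^2+1)^{-1}$ is compact. An even spectral triple is an odd spectral triple together with a grading operator $\Gamma:\mathcal H\to\mathcal H$ satisfying $\Gamma^*=\Gamma$, $\Gamma^2=1$, $\Gamma D=-D\Gamma$ and $\Gamma\pi(a)=\pi(a)\Gamma$ for all $a\in\mathcal A$. *)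

(* Defs.v *)
From HB Require Import structures.
From mathcomp Require Import all_boot all_order all_algebra.
From mathcomp Require Import all_classical all_reals all_analysis.
From mathcomp Require Import complex.
From mathcomp Require Import ring lra.

Set Implicit Arguments.
Unset Strict Implicit.
Unset Printing Implicit Defensive.

Import Order.TTheory GRing.Theory Num.Theory Normc numFieldNormedType.Exports.

Local Open Scope classical_set_scope.
Local Open Scope complex_scope.
Local Open Scope ring_scope.

HB.mixin Record isStarAlgebra (K : numClosedFieldType) A
    of GRing.Algebra K A := {
  star : A -> A ;
  starD : {morph star : a b / a + b} ;
  starZ : forall (k : K) a, star (k *: a) = k^* *: star a ;
  starM : forall a b, star (a * b) = star b * star a ;
  starK : involutive star
}.

#[short(type="starAlgType")]
HB.structure Definition StarAlgebra (K : numClosedFieldType) :=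
  {A of isStarAlgebra K A & GRing.Algebra K A}.

(* [inner] is linear in its first argument and conjugate-linear in the second. *)
HB.mixin Record NormedModule_isHilbert (R : realType) H
    of CompleteNormedModule R[i] H := {
  inner : {dot H for @Num.conj R[i]} ;
  innerE : forall x : H, inner x x = `|x| ^+ 2
}.

#[short(type="hilbertType")]
HB.structure Definition Hilbert (R : realType) :=
  {H of NormedModule_isHilbert R H & CompleteNormedModule R[i] H}.

(* A possibly unbounded operator on [H] is represented by its graph, a subset of
   [H * H]; algebraic operations are defined on their natural domains, so that
   an equality of graphs includes the equality of the domains. *)
Section unbounded_operators.
Variables (R : realType) (H : hilbertType R).
Implicit Types (S T : set (H * H)) (B : H -> H) (x y : H).

Definition op_graph B : set (H * H) := [set p | p.2 = B p.1].
Definition op_dom S : set H := [set x | exists y, S (x, y)].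
Definition op_opp S : set (H * H) := [set p | S (p.1, - p.2)].
Definition op_add S T : set (H * H) :=
  [set p | exists y z, [/\ S (p.1, y), T (p.1, z) & p.2 = y + z]].
(* first [T], then [S] *)
Definition op_comp S T : set (H * H) :=
  [set p | exists2 y, T (p.1, y) & S (y, p.2)].
Definition op_inv S : set (H * H) := [set p | S (p.2, p.1)].
Definition op_comm S T : set (H * H) :=
  op_add (op_comp S T) (op_opp (op_comp T S)).
Definition op_adjoint S : set (H * H) :=
  [set p | forall q, S q -> inner q.2 p.1 = inner q.1 p.2].

Definition linear_operator S : Prop :=
  [/\ forall x y z, S (x, y) -> S (x, z) -> y = z,
      S (0, 0) &
      forall (k : R[i]) p q, S p -> S q -> S (k *: p.1 + q.1, k *: p.2 + q.2)].

(* In [op_adjoint S] the pair [(x, y)] is present when <S u, x> = <u, y> for all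
   [u] in the domain of [S]. *)
Definition self_adjoint S : Prop :=
  [/\ linear_operator S, dense (op_dom S) & op_adjoint S = S].

Definition bounded_on S : Prop :=
  exists M : R, forall p, S p -> `|p.2| <= M%:C * `|p.1|.

Definition bounded_operator B : Prop := linear B /\ bounded_on (op_graph B).

(* [S] is the graph of an everywhere defined operator mapping the closed unit
   ball to a relatively compact set. *)
Definition compact_operator S : Prop :=
  exists B : H -> H, [/\ linear B, S = op_graph B &
    compact (closure (B @` [set x | `|x| <= 1]))].

(* [B] maps the domain of [S] to itself and the commutator, whose domain is then
   that of [S], is bounded there; the domain being dense when [S] is
   self-adjoint, the commutator extends to a bounded operator on [H]. *)
Definition bounded_commutator S B : Prop :=
  op_dom S `<=` op_dom (op_comp S (op_graph B)) /\
  bounded_on (op_comm S (op_graph B)).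

End unbounded_operators.

Section spectral_triples.
Variables (R : realType) (A : starAlgType R[i]) (H : hilbertType R).
Implicit Types (pi : A -> H -> H) (D : set (H * H)) (Gamma : H -> H).

(* unital *-representations *)
Definition bounded_representation pi : Prop :=
  [/\ forall a, bounded_operator (pi a),
      forall (k : R[i]) a b x, pi (k *: a + b) x = k *: pi a x + pi b x,
      forall x, pi 1 x = x,
      forall a b x, pi (a * b) x = pi a (pi b x) &
      forall a x y, inner (pi (star a) x) y = inner x (pi a y)].

Definition odd_spectral_triple pi D : Prop :=
  [/\ bounded_representation pi,
      self_adjoint D,
      forall a, bounded_commutator D (pi a) &
      compact_operator (op_inv (op_add (op_comp D D) (op_graph id)))].

(* [Gamma] is everywhere defined, so [op_comp D (op_graph Gamma)] has domain
   [Gamma @^-1` op_dom D]. *)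
Definition even_spectral_triple pi D Gamma : Prop :=
  odd_spectral_triple pi D /\
  [/\ bounded_operator Gamma,
      op_adjoint (op_graph Gamma) = op_graph Gamma,
      Gamma \o Gamma = id,
      op_comp (op_graph Gamma) D = op_opp (op_comp D (op_graph Gamma)) &
      forall a, Gamma \o pi a = pi a \o Gamma].

End spectral_triples.

Section unordered_sums.
Variables (R : realType) (V : choiceType).
Implicit Types f g : V -> R.

Definition usummable f := summable [set: V] (EFin \o f).

(* unordered sum of an absolutely summable family of reals: the sum of its
   positive parts minus the sum of its negative parts *)
Definition usum f : R :=
  fine (\esum_(v in [set: V]) (Num.max (f v) 0)%:E) -
  fine (\esum_(v in [set: V]) (Num.max (- f v) 0)%:E).

Lemma usummable_le f g : (forall v, `|f v| <= g v) -> usummable g -> usummable f.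
Proof.
move=> fg; apply: le_lt_trans; apply: le_esum => v _ /=.
by rewrite lee_fin (le_trans (fg v))// ler_norm.
Qed.

Lemma usummableD f g : usummable f -> usummable g -> usummable (f \+ g).
Proof. by move=> sf sg; have := summableD sf sg. Qed.

Lemma usummableN f : usummable f -> usummable (fun v => - f v).
Proof. by move=> sf; apply: le_lt_trans sf; apply: le_esum => v _ /=; rewrite normrN. Qed.

Lemma esum_real_fin f : (forall v, 0 <= f v) -> usummable f ->
  \esum_(v in [set: V]) (f v)%:E \is a fin_num.
Proof.
move=> f0; rewrite /usummable summableE; congr (_ \is a fin_num).
by apply: eq_esum => v _ /=; rewrite ger0_norm.
Qed.

Lemma usum_diff f g h : (forall v, 0 <= g v) -> (forall v, 0 <= h v) ->
    usummable g -> usummable h -> (forall v, f v = g v - h v) ->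
  usum f = fine (\esum_(v in [set: V]) (g v)%:E)
         - fine (\esum_(v in [set: V]) (h v)%:E).
Proof.
move=> g0 h0 sg sh fE.
have p0 v : 0 <= Num.max (f v) 0 by rewrite le_max lexx orbT.
have p1 v : 0 <= Num.max (- f v) 0 by rewrite le_max lexx orbT.
have sp : usummable (fun v => Num.max (f v) 0).
  apply: usummable_le sg => v; rewrite ger0_norm// ge_max g0 andbT fE.
  by rewrite lerBlDr lerDl.
have sn : usummable (fun v => Num.max (- f v) 0).
  apply: usummable_le sh => v; rewrite ger0_norm//.
  by rewrite ge_max h0 andbT fE opprB lerBlDr lerDl.
have [P N G K] := And4 (esum_real_fin p0 sp) (esum_real_fin p1 sn)
  (esum_real_fin g0 sg) (esum_real_fin h0 sh).
apply/eqP; rewrite /usum subr_eq addrAC eq_sym subr_eq eq_sym; apply/eqP.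
rewrite -!fineD// -!esumD//; try by move=> v _; rewrite lee_fin.
congr fine; apply: eq_esum => v _; rewrite -!EFinD fE; congr EFin.
rewrite opprB /Num.max; case: ltgtP => gh; case: ltgtP => hg; lra.
Qed.

Lemma usumE f : (forall v, 0 <= f v) -> usummable f ->
  usum f = fine (\esum_(v in [set: V]) (f v)%:E).
Proof.
move=> f0 sf; have s0 : usummable (fun=> 0 : R).
  by rewrite /usummable /summable esum1//= => v _; rewrite normr0.
have fE v : f v = f v - 0 by rewrite subr0.
by rewrite (usum_diff f0 _ sf s0 fE)// (esum1 (a := fun=> 0%:E))// subr0.
Qed.

Lemma usum_eq f g : f =1 g -> usum f = usum g.
Proof. by move=> /funext ->. Qed.

Lemma usumN f : usum (fun v => - f v) = - usum f.
Proof.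
rewrite /usum opprB; congr (_ - fine _); apply: eq_esum => v _.
by rewrite opprK.
Qed.

Let pos f v : 0 <= Num.max (f v) 0 :> R. Proof. by rewrite le_max lexx orbT. Qed.

Lemma usummable_pos f : usummable f -> usummable (fun v => Num.max (f v) 0).
Proof.
move=> sf; apply: le_lt_trans sf; apply: le_esum => v _ /=.
by rewrite lee_fin ger0_norm// ge_max ler_norm normr_ge0.
Qed.

Lemma usumD f g : usummable f -> usummable g ->
  usum (f \+ g) = usum f + usum g.
Proof.
move=> sf sg.
have [fp gp] := (usummable_pos sf, usummable_pos sg).
have fn := usummable_pos (usummableN sf).
have gn := usummable_pos (usummableN sg).
have pfn v : 0 <= Num.max (- f v) 0 by exact: (pos (fun v => - f v)).
have pgn v : 0 <= Num.max (- g v) 0 by exact: (pos (fun v => - g v)).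
have [P N G K] := And4 (esum_real_fin (pos f) fp) (esum_real_fin pfn fn)
  (esum_real_fin (pos g) gp) (esum_real_fin pgn gn).
rewrite (@usum_diff _ (fun v => Num.max (f v) 0 + Num.max (g v) 0)
  (fun v => Num.max (- f v) 0 + Num.max (- g v) 0)).
- rewrite (esumD (a := fun v => (Num.max (f v) 0)%:E)
     (b := fun v => (Num.max (g v) 0)%:E))//; try by move=> ? _; rewrite lee_fin.
  rewrite (esumD (a := fun v => (Num.max (- f v) 0)%:E)
     (b := fun v => (Num.max (- g v) 0)%:E))//; try by move=> ? _; rewrite lee_fin.
  by rewrite !fineD// /usum opprD addrACA.
- by move=> v; rewrite addr_ge0.
- by move=> v; rewrite addr_ge0.
- exact: usummableD.
- exact: usummableD.
- move=> v /=; rewrite /Num.max; case: ltgtP => ?; case: ltgtP => ?;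
    case: ltgtP => ?; case: ltgtP => ?; lra.
Qed.

Lemma esum_realZ (c : R) f : 0 <= c -> (forall v, 0 <= f v) ->
  (\esum_(v in [set: V]) (c * f v)%:E = c%:E * \esum_(v in [set: V]) (f v)%:E)%E.
Proof.
have le_ (d : R) g : 0 <= d -> (forall v, 0 <= g v) ->
    (\esum_(v in [set: V]) (d * g v)%:E <= d%:E * \esum_(v in [set: V]) (g v)%:E)%E.
  move=> d0 g0; apply: ge_ereal_sup => /= _ [X [finX _] <-].
  rewrite (eq_fsbigr (fun v => (d%:E * (g v)%:E)%E)); last by move=> v _; rewrite EFinM.
  rewrite -ge0_mule_fsumr; last by move=> v; rewrite lee_fin.
  by rewrite lee_wpmul2l ?lee_fin// esum_ge//; exists X.
move=> c0 f0; apply/eqP; rewrite eq_le le_//=.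
have [->|c_neq0] := eqVneq c 0.
  by rewrite mul0e esum_ge0// => v _; rewrite mul0r.
have cp : 0 < c by rewrite lt_def c_neq0.
have := @le_ c^-1 (fun v => c * f v).
rewrite invr_ge0 => /(_ c0 (fun v => mulr_ge0 c0 (f0 v))) {}le_.
rewrite (eq_esum (b := fun v => (c^-1 * (c * f v))%:E)); last first.
  by move=> v _; rewrite mulKf.
apply: le_trans (lee_wpmul2l _ le_) _; first by rewrite lee_fin.
by rewrite muleA -EFinM mulfV// mul1e.
Qed.

Lemma usummableZ (c : R) f : usummable f -> usummable (fun v => c * f v).
Proof.
rewrite /usummable /summable => sf.
under eq_esum do rewrite /= normrM.
by rewrite esum_realZ// lte_mul_pinfty// lee_fin.
Qed.

Lemma usumZ (c : R) f : usum (fun v => c * f v) = c * usum f.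
Proof.
wlog c0 : c f / 0 <= c.
  move=> h; have [/h//|c0] := leP 0 c.
  rewrite (@usum_eq _ (fun v => - c * - f v)).
    by rewrite (h (- c)) ?oppr_ge0 1?ltW// usumN mulrNN.
  by move=> v; rewrite mulrNN.
have e g : (\esum_(v in [set: V]) (Num.max (c * g v) 0)%:E =
            c%:E * \esum_(v in [set: V]) (Num.max (g v) 0)%:E)%E.
  rewrite -esum_realZ//.
  by apply: eq_esum => v _; rewrite maxr_pMr// mulr0.
rewrite /usum e.
under [in X in _ - X]eq_esum do rewrite -mulrN.
rewrite (e (fun v => - f v)).
have fineZ (x : \bar R) : fine (c%:E * x)%E = c * fine x.
  case: x => [r//||]; rewrite /= ?mulr0.
    by rewrite /mule/=; case: eqP => //; case: ifP.
  by rewrite /mule/=; case: eqP => //; case: ifP.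
by rewrite !fineZ mulrBr.
Qed.

End unordered_sums.

(* the Hilbert space of square-summable functions [V -> C^2] *)
Section hilbert_sum.
Variables (R : realType) (V : choiceType).
Local Notation C2 := 'cV[R[i]]_2.
Local Notation Re := complex.Re.
Local Notation Im := complex.Im.

Definition sqnorm (z : C2) : R := \sum_(i < 2) (normc (z i 0)) ^+ 2.

Definition inner2 (z w : C2) : R[i] := \sum_(i < 2) z i 0 * (w i 0)^*.

Definition square_summable : pred (V -> C2) :=
  [pred f | `[< \esum_(v in [set: V]) (sqnorm (f v))%:E < +oo >]%E].

Definition csum (f : V -> R[i]) : R[i] :=
  usum (fun v => Re (f v)) +i* usum (fun v => Im (f v)).

Lemma sqnormE z : sqnorm z = \sum_(i < 2) (Re (z i 0) ^+ 2 + Im (z i 0) ^+ 2).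
Proof.
apply: eq_bigr => i _; case: (z i 0) => a b /=.
by rewrite sqr_sqrtr// addr_ge0// sqr_ge0.
Qed.

Lemma sqnorm_ge0 z : 0 <= sqnorm z.
Proof. by apply: sumr_ge0 => i _; exact: sqr_ge0. Qed.

Lemma square_summableP (f : V -> C2) :
  reflect (usummable (fun v => sqnorm (f v))) (f \in square_summable).
Proof.
apply: (iffP idP) => [/asboolP|] h; last apply/asboolP; move: h;
  rewrite /usummable /summable; congr (_ < _)%E; apply: eq_esum => v _ /=;
  by rewrite ger0_norm// sqnorm_ge0.
Qed.

Lemma sqnormD z w : sqnorm (z + w) <= 2 * (sqnorm z + sqnorm w).
Proof.
rewrite !sqnormE -big_split mulr_sumr; apply: ler_sum => i _; rewrite !mxE.
case: (z i 0) (w i 0) => [a b] [c d] /=.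
have := sqr_ge0 (a - c); have := sqr_ge0 (b - d); nra.
Qed.

Lemma sqnormZ k z : sqnorm (k *: z) = (normc k) ^+ 2 * sqnorm z.
Proof.
rewrite /sqnorm mulr_sumr; apply: eq_bigr => i _; rewrite !mxE normcM.
by rewrite exprMn.
Qed.

Lemma inner2_le z w :
  `|Re (inner2 z w)| <= sqnorm z + sqnorm w /\
  `|Im (inner2 z w)| <= sqnorm z + sqnorm w.
Proof.
rewrite !sqnormE /inner2 !big_ord_recl !big_ord0.
case: (z _ _) (z _ _) (w _ _) (w _ _) => [a b] [c d] [a' b'] [c' d'] /=.
have := sqr_ge0 (a - a'); have := sqr_ge0 (b - b'); have := sqr_ge0 (c - c').
have := sqr_ge0 (d - d'); have := sqr_ge0 (a + a'); have := sqr_ge0 (b + b').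
have := sqr_ge0 (c + c'); have := sqr_ge0 (d + d').
have := sqr_ge0 (a - b'); have := sqr_ge0 (b - a'); have := sqr_ge0 (c - d').
have := sqr_ge0 (d - c'); have := sqr_ge0 (a + b'); have := sqr_ge0 (b + a').
have := sqr_ge0 (c + d'); have := sqr_ge0 (d + c').
by move=> *; split; rewrite ler_norml; apply/andP; split; nra.
Qed.

Fact square_summable_closed : GRing.subsemimod_closed square_summable.
Proof.
split; [split|].
- apply/square_summableP; rewrite /usummable /summable esum1//= => v _.
  by rewrite sqnormE big1 ?normr0// => i _; rewrite !mxE/= expr0n/= addr0.
- move=> f g /square_summableP sf /square_summableP sg; apply/square_summableP.
  apply: (usummable_le (g := fun v => 2 * (sqnorm (f v) + sqnorm (g v)))).
    by move=> v; rewrite ger0_norm ?sqnorm_ge0// sqnormD.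
  by apply: (@usummableZ _ _ _ (fun v => sqnorm (f v) + sqnorm (g v)));
    exact: usummableD.
- move=> k f /square_summableP sf; apply/square_summableP.
  apply: (usummable_le (g := fun v => normc k ^+ 2 * sqnorm (f v))).
    by move=> v; rewrite ger0_norm ?sqnorm_ge0// sqnormZ.
  exact: usummableZ.
Qed.

HB.instance Definition _ :=
  GRing.isSubSemiModClosed.Build R[i] (V -> C2) square_summable square_summable_closed.

Record l2 := L2 { l2_fun :> V -> C2 ; l2_proof : l2_fun \in square_summable }.

HB.instance Definition _ := [isSub of l2 for l2_fun].
HB.instance Definition _ := [Choice of l2 by <:].
HB.instance Definition _ := [SubChoice_isSubLmodule of l2 by <:].

Definition csummable (f : V -> R[i]) :=
  usummable (fun v => Re (f v)) /\ usummable (fun v => Im (f v)).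

Lemma csumD f g : csummable f -> csummable g ->
  csum (fun v => f v + g v) = csum f + csum g.
Proof.
move=> [rf imf] [rg img].
rewrite /csum (_ : _ +i* _ + _ = (usum (fun v => Re (f v)) +
  usum (fun v => Re (g v))) +i* (usum (fun v => Im (f v)) +
  usum (fun v => Im (g v))))//.
rewrite -!usumD//; congr (_ +i* _); apply: usum_eq => v /=.
  by case: (f v) (g v) => [? ?] [? ?].
by case: (f v) (g v) => [? ?] [? ?].
Qed.

Lemma csumZ k f : csummable f -> csum (fun v => k * f v) = k * csum f.
Proof.
case: k => a b [rf imf]; rewrite /csum.
rewrite (_ : _ * (_ +i* _) = (a * usum (fun v => Re (f v)) -
  b * usum (fun v => Im (f v))) +i* (a * usum (fun v => Im (f v)) +
  b * usum (fun v => Re (f v))))//.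
congr (_ +i* _).
  rewrite -!usumZ -usumN -usumD; [|exact: usummableZ|exact/usummableN/usummableZ].
  by apply: usum_eq => v /=; case: (f v).
rewrite -!usumZ -usumD; [|exact: usummableZ|exact: usummableZ].
by apply: usum_eq => v /=; case: (f v).
Qed.

Lemma csum_conj f : csum (fun v => (f v)^*) = (csum f)^*.
Proof.
rewrite /csum (_ : (_ +i* _)^* = usum (fun v => Re (f v)) +i*
  - usum (fun v => Im (f v)))//.
rewrite -usumN; congr (_ +i* _); apply: usum_eq => v; by case: (f v).
Qed.

Definition l2_inner (f g : l2) : R[i] := csum (fun v => inner2 (f v) (g v)).

Lemma l2_sqnorm_summable (f : l2) : usummable (fun v => sqnorm (f v)).
Proof. exact/square_summableP/l2_proof. Qed.

Lemma l2_inner_summable (f g : l2) : csummable (fun v => inner2 (f v) (g v)).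
Proof.
by split; (apply: (usummable_le (g := fun v => sqnorm (f v) + sqnorm (g v)));
  [move=> v; have [] := inner2_le (f v) (g v)
  |apply: usummableD; exact: l2_sqnorm_summable]).
Qed.

Lemma l2_innerD f g h : l2_inner (f + g) h = l2_inner f h + l2_inner g h.
Proof.
rewrite -csumD; [|exact: l2_inner_summable..].
congr csum; apply/funext => v; rewrite /inner2 -big_split.
by apply: eq_bigr => i _; rewrite /= !mxE mulrDl.
Qed.

Lemma l2_innerZ k f g : l2_inner (k *: f) g = k * l2_inner f g.
Proof.
rewrite -csumZ; last exact: l2_inner_summable.
congr csum; apply/funext => v; rewrite /inner2 mulr_sumr.
by apply: eq_bigr => i _; rewrite !mxE mulrA.
Qed.

Lemma l2_inner_conj f g : l2_inner f g = (l2_inner g f)^*.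
Proof.
rewrite -csum_conj; congr csum; apply/funext => v; rewrite /inner2 rmorph_sum.
by apply: eq_bigr => i _; rewrite rmorphM/= conjCK mulrC.
Qed.

Lemma inner2_sqnorm z : inner2 z z = (sqnorm z)%:C.
Proof.
rewrite /sqnorm rmorph_sum; apply: eq_bigr => i _.
case: (z i 0) => a b; rewrite /= sqr_sqrtr ?addr_ge0 ?sqr_ge0//.
apply/eqP; rewrite eq_complex /=; apply/andP; split; apply/eqP; ring.
Qed.

Definition l2_sqnorm (f : l2) : R :=
  fine (\esum_(v in [set: V]) (sqnorm (f v))%:E).

Lemma l2_sqnorm_ge0 f : 0 <= l2_sqnorm f.
Proof. by apply/fine_ge0/esum_ge0 => v _; rewrite lee_fin sqnorm_ge0. Qed.

Lemma l2_innerE f : l2_inner f f = (l2_sqnorm f)%:C.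
Proof.
rewrite /l2_inner /csum; congr (_ +i* _).
  rewrite /l2_sqnorm -usumE; [|by move=> v; exact: sqnorm_ge0|exact: l2_sqnorm_summable].
  by apply: usum_eq => v; rewrite inner2_sqnorm.
have -> : 0 = usum (fun v : V => 0 * 0 : R) by rewrite (usumZ 0 (fun=> 0)) mul0r.
by apply: usum_eq => v; rewrite inner2_sqnorm mul0r.
Qed.

Lemma le_l2_sqnorm (f : l2) v : sqnorm (f v) <= l2_sqnorm f.
Proof.
rewrite -lee_fin fineK.
  rewrite esum_ge//; exists [set v]; first by split.
  by rewrite fsbig_set1.
by rewrite esum_real_fin//; [move=> w; exact: sqnorm_ge0|exact: l2_sqnorm_summable].
Qed.

Lemma l2_sqnorm_eq0 (f : l2) : l2_sqnorm f = 0 -> f = 0.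
Proof.
move=> f0; apply/val_inj/funext => v; apply/matrixP => i j; rewrite ord1 !mxE.
have : sqnorm (f v) == 0 by rewrite eq_le sqnorm_ge0 -f0 le_l2_sqnorm.
rewrite psumr_eq0 => [|k _]; last exact: sqr_ge0.
by move=> /allP/(_ i (mem_index_enum _)); rewrite /= sqrf_eq0 => /eqP/eq0_normc.
Qed.

Fact l2_inner_bilinear :
  bilinear_for (GRing.Scale.Law.clone _ _ ( *%R ) _)
    (GRing.Scale.Law.clone _ _ (Num.conj \; *%R ) _) l2_inner.
Proof.
split=> g k a b /=.
  by rewrite l2_innerD l2_innerZ.
by rewrite l2_inner_conj l2_innerD l2_innerZ rmorphD rmorphM /= -!l2_inner_conj.
Qed.

HB.instance Definition _ := bilinear_isBilinear.Build R[i] l2 l2 R[i] _ _ l2_inner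
  l2_inner_bilinear.

Fact l2_inner_hermitian f g : l2_inner f g = (-1) ^+ false * (l2_inner g f)^*.
Proof. by rewrite expr0 mul1r -l2_inner_conj. Qed.

HB.instance Definition _ :=
  isHermitianSesquilinear.Build _ _ _ _ l2_inner l2_inner_hermitian.

Fact l2_inner_gt0 f : f != 0 -> 0 < l2_inner f f.
Proof.
move=> f0; rewrite l2_innerE ltcR lt_def l2_sqnorm_ge0 andbT.
by apply: contra_neq f0; exact: l2_sqnorm_eq0.
Qed.

HB.instance Definition _ := isDotProduct.Build _ _ l2_inner l2_inner_gt0.

Lemma l2_cauchy_schwarz f g :
  Re (l2_inner f g) ^+ 2 <= l2_sqnorm f * l2_sqnorm g.
Proof.
pose p := l2_sqnorm f; pose q := l2_sqnorm g; pose c := Re (l2_inner f g).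
have h (t : R) : 0 <= q * t ^+ 2 + 2 * c * t + p.
  have := l2_sqnorm_ge0 (f + t%:C *: g).
  rewrite -ler0c -l2_innerE l2_innerD l2_innerZ.
  rewrite (l2_inner_conj f) (l2_inner_conj g (_ + _)) !l2_innerD !l2_innerZ !l2_innerE.
  rewrite (l2_inner_conj g f) /p /q /c; case: (l2_inner f g) => x y.
  rewrite lecE /= => /andP[_]; congr (_ <= _); ring.
rewrite -/c -/p -/q; have p0 : 0 <= p := l2_sqnorm_ge0 f.
have q0 : 0 <= q := l2_sqnorm_ge0 g.
have [q_eq0|q_neq0] := eqVneq q 0.
  suff -> : c = 0 by rewrite expr0n/= mulr_ge0.
  apply/eqP; apply: contraT => c0.
  have := h (- (p + 1) / (2 * c)); rewrite q_eq0 mul0r add0r mulrC divfK.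
    by lra.
  by rewrite mulf_neq0.
have qp : 0 < q by rewrite lt_def q_neq0.
have := h (- c / q); rewrite -(pmulr_rge0 _ qp).
have -> : q * (q * (- c / q) ^+ 2 + 2 * c * (- c / q) + p) = p * q - c ^+ 2.
  by field.
by rewrite subr_ge0.
Qed.

Definition l2_norm (f : l2) : R[i] := (Num.sqrt (l2_sqnorm f))%:C.

Lemma l2_sqnormD f g :
  l2_sqnorm (f + g) = l2_sqnorm f + l2_sqnorm g + 2 * Re (l2_inner f g).
Proof.
have : (l2_sqnorm (f + g))%:C = l2_inner f f + l2_inner g g +
    (l2_inner f g + (l2_inner f g)^*).
  rewrite -l2_innerE l2_innerD (l2_inner_conj f) (l2_inner_conj g (_ + _)).
  rewrite !l2_innerD !rmorphD/= -!l2_inner_conj; ring.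
rewrite !l2_innerE; case: (l2_inner f g) => x y /(congr1 (@Re R))/= ->.
ring.
Qed.

Fact l2_normD f g : l2_norm (f + g) <= l2_norm f + l2_norm g.
Proof.
rewrite /l2_norm -rmorphD lecR -(@ler_sqr R) ?nnegrE ?addr_ge0 ?sqrtr_ge0//.
rewrite sqrrD !sqr_sqrtr ?l2_sqnorm_ge0// l2_sqnormD [leRHS]addrAC lerD2l.
rewrite -[leRHS]mulr_natl ler_pM2l// -sqrtrM ?l2_sqnorm_ge0//.
rewrite (le_trans (ler_norm _))// -sqrtr_sqr ler_wsqrtr//.
exact: l2_cauchy_schwarz.
Qed.

Fact l2_normZ k f : l2_norm (k *: f) = `|k| * l2_norm f.
Proof.
have -> : l2_norm (k *: f) = (Num.sqrt (normc k ^+ 2 * l2_sqnorm f))%:C.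
  congr (Num.sqrt _)%:C; apply/eqP; rewrite -(inj_eq (@complexI R)) rmorphM.
  rewrite /= -!l2_innerE l2_innerZ l2_inner_conj l2_innerZ rmorphM/=.
  rewrite -l2_inner_conj mulrA -normCK; apply/eqP; congr (_ * _).
  by rewrite rmorphXn.
by rewrite sqrtrM ?sqr_ge0// sqrtr_sqr rmorphM/= ger0_norm//; case: k => a b; rewrite sqrtr_ge0.
Qed.

Fact l2_norm_eq0 f : l2_norm f = 0 -> f = 0.
Proof.
move=> /(congr1 (@Re R))/eqP /=; rewrite sqrtr_eq0 => f0.
by apply/l2_sqnorm_eq0/eqP; rewrite eq_le f0 l2_sqnorm_ge0.
Qed.

HB.instance Definition _ :=
  Lmodule_isNormed.Build R[i] l2 l2_normD l2_normZ l2_norm_eq0.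

Lemma sqnormB z w : sqnorm (z - w) = \sum_(i < 2)
  ((Re (z i 0) - Re (w i 0)) ^+ 2 +
   (Im (z i 0) - Im (w i 0)) ^+ 2).
Proof.
rewrite sqnormE; apply: eq_bigr => i _; rewrite !mxE.
by case: (z i 0) (w i 0) => ? ? [].
Qed.

Lemma l2_normE (f : l2) : `|f| = (Num.sqrt (l2_sqnorm f))%:C.
Proof. by []. Qed.

Lemma l2_norm_lt (f : l2) (e : R) : 0 < e ->
  (`|f| < e%:C) = (l2_sqnorm f < e ^+ 2).
Proof.
move=> e0; rewrite l2_normE ltcR -[in LHS](ger0_norm (ltW e0)) -sqrtr_sqr.
by rewrite ltr_sqrt// exprn_gt0.
Qed.

Fact l2_complete (F : set_system l2) : ProperFilter F -> cauchy F -> cvg F.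
Proof.
move=> FF /cauchy_ballP cF.
have {}cF (e : R) : 0 < e -> exists2 A : set l2, F A &
    forall f g, A f -> A g -> l2_sqnorm (f - g) < e ^+ 2.
  move=> e0; have ec : 0 < e%:C :> R[i] by rewrite ltcR.
  have [[A B] /= [FA FB] AB] := cF _ ec.
  exists (A `&` B); first exact: filterI.
  move=> f g [Af _] [_ Bg]; have := AB (f, g) (conj Af Bg).
  by rewrite /= -ball_normE/= l2_norm_lt.
have cvg_sum (I : Type) (r : seq I) (h : I -> l2 -> R) (a : I -> R) :
    (forall i, h i g @[g --> F] --> a i) ->
    \sum_(i <- r) h i g @[g --> F] --> \sum_(i <- r) a i.
  by move=> ha; apply: cvg_big => // -[x y]; exact: add_continuous.
have coord_le (f : l2) v i : Re (f v i 0) ^+ 2 <= l2_sqnorm f /\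
    Im (f v i 0) ^+ 2 <= l2_sqnorm f.
  have : Re (f v i 0) ^+ 2 + Im (f v i 0) ^+ 2 <= l2_sqnorm f.
    apply: le_trans (le_l2_sqnorm f v); rewrite sqnormE (bigD1 i)//= lerDl.
    by apply: sumr_ge0 => j _; rewrite addr_ge0 ?sqr_ge0.
  have := sqr_ge0 (Re (f v i 0)); have := sqr_ge0 (Im (f v i 0)).
  by move=> *; split; lra.
have cvg_coord (c : l2 -> R) : (forall f g, c (f - g) = c f - c g) ->
    (forall f, c f ^+ 2 <= l2_sqnorm f) -> cvg (c @ F).
  move=> cB c_le; apply/cauchy_cvgP/cauchy_ballP => e e0.
  have [A FA AE] := cF _ e0.
  exists (c @` A, c @` A) => /=.
    by split; apply: (@filterS _ F _ A) => // f Af; exists f.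
  move=> [_ _] [/= [f Af <-] [g Ag <-]]; rewrite -ball_normE/= -cB.
  rewrite -[ltRHS](ger0_norm (ltW e0)) -ltr_sqr ?nnegrE//.
  by rewrite !real_normK ?num_real// (le_lt_trans (c_le _))// AE.
pose re v i (f : l2) := Re (f v i 0).
pose im v i (f : l2) := Im (f v i 0).
have subE (f g : l2) v i : (f - g) v i 0 = f v i 0 - g v i 0 by rewrite /= !mxE.
have cre v i : re v i f @[f --> F] --> lim (re v i f @[f --> F]).
  apply: cvg_coord => [f g|f]; last by have [] := coord_le f v i.
  by rewrite /re subE; case: (f v i 0) (g v i 0) => ? ? [].
have cim v i : im v i f @[f --> F] --> lim (im v i f @[f --> F]).
  apply: cvg_coord => [f g|f]; last by have [] := coord_le f v i.
  by rewrite /im subE; case: (f v i 0) (g v i 0) => ? ? [].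
pose L v : C2 := \col_i (lim (re v i f @[f --> F]) +i* lim (im v i f @[f --> F])).
have close (e : R) : 0 < e -> exists2 A : set l2, F A & forall f, A f ->
    (\esum_(v in [set: V]) (sqnorm (f v - L v)) %:E <= (e ^+ 2)%:E)%E.
  move=> e0; have [A FA AE] := cF _ e0; exists A => // f Af.
  apply: ge_ereal_sup => /= _ [X [finX _] <-].
  rewrite fsbig_finite//= sumEFin lee_fin.
  have sq_cvg v : sqnorm (f v - (g : l2) v) @[g --> F] --> sqnorm (f v - L v).
    under eq_cvg do rewrite sqnormB.
    rewrite sqnormB; apply: cvg_sum => i; rewrite /L mxE /=.
    apply: cvgD.
      by apply: cvgM; (apply: cvgB; [exact: cvg_cst|exact: cre]).
    by apply: cvgM; (apply: cvgB; [exact: cvg_cst|exact: cim]).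
  have sum_cvg : \sum_(v <- finmap.enum_fset (fset_set X)) sqnorm (f v - (g : l2) v) @[g --> F] -->
      \sum_(v <- finmap.enum_fset (fset_set X)) sqnorm (f v - L v).
    by apply: cvg_sum => v; exact: sq_cvg.
  apply: (cvgr_to_le sum_cvg).
  apply: filterS FA => g Ag; rewrite -lee_fin.
  have /ltW := AE _ _ Af Ag; rewrite -lee_fin; apply: le_trans.
  rewrite /l2_sqnorm fineK; last first.
    by apply: esum_real_fin; [move=> v; exact: sqnorm_ge0|exact: l2_sqnorm_summable].
  rewrite esum_ge//; exists X => //.
  rewrite fsbig_finite//= sumEFin.
  by apply: le_refl.
have [A0 FA0 A0E] := close 1 ltr01.
have [f0 Af0] := filter_ex FA0.
have fL : (fun v => f0 v - L v) \in square_summable.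
  by apply/asboolP; rewrite (le_lt_trans (A0E _ Af0))// ltry.
have L2L : L \in square_summable.
  rewrite (_ : L = (f0 : V -> C2) - (fun v => f0 v - L v)).
    have := square_summable_closed => -[[_ D] Z].
    rewrite -scaleN1r; apply: D; [exact: l2_proof|exact: Z].
  by apply/funext => v; rewrite !fctE subKr.
apply/cvg_ex; exists (L2 L2L); apply/cvg_ballP => e.
case: e => e e'; rewrite ltcE /= => /andP[/eqP -> e0]; rewrite -[e +i* 0]/(e%:C).
have e20 : 0 < e / 2 by rewrite divr_gt0.
have [A FA AE] := close _ e20.
apply: filterS FA => f Af; rewrite -ball_normE/= distrC l2_norm_lt//.
apply: (@le_lt_trans _ _ ((e / 2) ^+ 2)).
  have := AE _ Af; rewrite -lee_fin /l2_sqnorm fineK//.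
  by apply: esum_real_fin; [move=> v; exact: sqnorm_ge0|exact: l2_sqnorm_summable].
by rewrite ltr_sqr ?nnegrE ?ltW// ltr_pdivrMr// ltr_pMr// ltr1n.
Qed.

HB.instance Definition _ := Uniform_isComplete.Build l2 l2_complete.

Fact l2_inner_norm (f : l2) : l2_inner f f = `|f| ^+ 2.
Proof. by rewrite l2_innerE l2_normE -rmorphXn/= sqr_sqrtr ?l2_sqnorm_ge0. Qed.

HB.instance Definition _ := NormedModule_isHilbert.Build R l2 l2_inner_norm.

End hilbert_sum.

Section diagonal_operators.
Variables (R : realType) (V : choiceType).

Definition diag2 (a b : R[i]) : 'M[R[i]]_2 :=
  diag_mx (\row_(i < 2) if i == 0 then a else b).

Definition sigma1 : 'M[R[i]]_2 := \matrix_(i, j) (i != j)%:R.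

Definition bounded_family (a : V -> R[i]) : Prop :=
  exists k : R, forall v, `|a v| <= k%:C.

Lemma diag2_square_summable (a b : V -> R[i]) (f : l2 R V) :
  bounded_family a -> bounded_family b ->
  (fun v => diag2 (a v) (b v) *m f v) \in @square_summable R V.
Proof.
move=> [k ak] [l bl]; apply/square_summableP.
apply: (usummable_le (g := fun v => (k ^+ 2 + l ^+ 2) * sqnorm (f v))).
  move=> v; rewrite ger0_norm ?sqnorm_ge0// /sqnorm mulr_sumr.
  have le_sqr (z : R[i]) (m : R) : `|z| <= m%:C -> normc z ^+ 2 <= m ^+ 2.
    by case: z => x y /=; rewrite lecR => h; rewrite lerXn2r ?nnegrE ?sqrtr_ge0// (le_trans _ h) ?sqrtr_ge0.
  apply: ler_sum => i _; rewrite mul_diag_mx !mxE normcM exprMn.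
  apply: ler_wpM2r; first exact: sqr_ge0.
  case: ifP => _.
    by rewrite (le_trans (le_sqr _ _ (ak v)))// lerDl sqr_ge0.
  by rewrite (le_trans (le_sqr _ _ (bl v)))// lerDr sqr_ge0.
exact/usummableZ/l2_sqnorm_summable.
Qed.

Definition diag_op (a b : V -> R[i]) (ha : bounded_family a)
    (hb : bounded_family b) (f : l2 R V) : l2 R V :=
  L2 (diag2_square_summable f ha hb).

Lemma bounded_family_cst (c : R[i]) : bounded_family (fun=> c).
Proof. by exists (normc c) => _; case: c. Qed.

(* 1 (x) sigma_3 *)
Definition grading : l2 R V -> l2 R V :=
  diag_op (bounded_family_cst 1) (bounded_family_cst (-1)).

End diagonal_operators.

Arguments grading : clear implicits.

(* Cantor sets with a regular ultrametric: in a [metricType] the topology is by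
   construction the one induced by the metric, whence metrizability of the space
   and regularity of [mdist]. *)
HB.mixin Record isUltrametricCantor (R : realType) C of Metric R C := {
  cantor_nonempty : [set: C] !=set0 ;
  cantor_compact : compact [set: C] ;
  cantor_totally_disconnected : totally_disconnected [set: C] ;
  cantor_no_isolated_point : isolated [set: C] = set0 ;
  mdist_ultra : forall x y z : C,
    mdist x y <= Num.max (mdist x z) (mdist z y)
}.

#[short(type="ultrametricCantorType")]
HB.structure Definition UltrametricCantor (R : realType) :=
  {C of isUltrametricCantor R C & Metric R C}.

Section lipschitz_algebra.
Variables (R : realType) (C : ultrametricCantorType R).

Let realcD (x y : R) : (x + y)%:C = x%:C + y%:C.
Proof. exact: (rmorphD (real_complex R)). Qed.

Let realcM (x y : R) : (x * y)%:C = x%:C * y%:C.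
Proof. exact: (rmorphM (real_complex R)). Qed.

Definition lipschitz_fun : pred (C -> R[i]) :=
  [pred f | `[< exists k : R,
    forall x y : C, `|f x - f y| <= (k * mdist x y)%:C >]].

Lemma lipschitz_bounded (f : C -> R[i]) : f \in lipschitz_fun ->
  exists k : R, forall x, `|f x| <= k%:C.
Proof.
move=> /asboolP[k fk]; have [x0 _] := cantor_nonempty (s := C).
have [n xn] : exists n : nat, forall x : C, mdist x0 x < n%:R.
  have := (compact_near_coveringP [set: C]).1 cantor_compact nat \oo
    (fun n x => mdist x0 x < n%:R) _.
  case=> [x _|N _ /(_ N (leqnn _)) xN]; last by exists N => x; exact: xN.
  pose N := Num.trunc (mdist x0 x + 1).
  exists (ball x 1, [set n | (N < n)%N]).
    split; first exact: nbhsx_ballx.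
    by exists N.+1.
  move=> [y n] [/=]; rewrite ballEmdist/= => xy Nn.
  have := metric_triangle x0 x y; move/le_lt_trans; apply.
  apply: (@lt_le_trans _ _ (mdist x0 x + 1)); first by rewrite ltrD2l.
  by apply: (le_trans (ltW (truncnS_gt _))); rewrite ler_nat.
exists (normc (f x0) + `|k| * n%:R) => x.
rewrite -[f x](subrK (f x0)) addrC (le_trans (ler_normD _ _))// realcD lerD//.
rewrite -normrN opprB (le_trans (fk _ _))// lecR.
rewrite (le_trans (ler_wpM2r (mdist_ge0 _ _) (ler_norm k)))//.
by rewrite ler_wpM2l// ltW.
Qed.

Fact lipschitz_subring : GRing.subring_closed lipschitz_fun.
Proof.
split=> [|f g /asboolP[k fk] /asboolP[l gl]|f g fL gL].
- by apply/asboolP; exists 0 => x y; rewrite subrr normr0 mul0r.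
- apply/asboolP; exists (k + l) => x y; rewrite !fctE.
  rewrite (_ : _ - _ = (f x - f y) - (g x - g y)); last by ring.
  by rewrite mulrDl realcD (le_trans (ler_normB _ _))// lerD.
have [a fa] := lipschitz_bounded fL; have [b gb] := lipschitz_bounded gL.
move: fL gL => /asboolP[k fk] /asboolP[l gl]; apply/asboolP.
exists (a * l + k * b) => x y; rewrite !fctE.
rewrite (_ : _ - _ = f x * (g x - g y) + (f x - f y) * g y); last by ring.
rewrite (mulrDl (a * l)) realcD (le_trans (ler_normD _ _))// !normrM lerD//.
  by rewrite -mulrA realcM ler_pM.
by rewrite mulrAC realcM ler_pM.
Qed.

Fact lipschitz_scale : GRing.scaler_closed lipschitz_fun.
Proof.
move=> c f /asboolP[k fk]; apply/asboolP; exists (normc c * k) => x y.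
rewrite !fctE -scalerBr normrM -mulrA realcM ler_pM//.
Qed.

HB.instance Definition _ :=
  GRing.isSubringClosed.Build (C -> R[i]) lipschitz_fun lipschitz_subring.
HB.instance Definition _ :=
  GRing.isScaleClosed.Build R[i] (C -> R[i]) lipschitz_fun lipschitz_scale.

Record Lip := MkLip { Lip_fun :> C -> R[i] ; Lip_proof : Lip_fun \in lipschitz_fun }.

HB.instance Definition _ := [isSub of Lip for Lip_fun].
HB.instance Definition _ := [Choice of Lip by <:].
HB.instance Definition _ :=
  GRing.SubChoice_isSubComPzRing.Build (C -> R[i]) lipschitz_fun Lip lipschitz_subring.
HB.instance Definition _ := [SubZmodule_isSubLmodule of Lip by <:].

Fact Lip_oner_neq0 : 1 != 0 :> Lip.
Proof.
have [x0 _] := cantor_nonempty (s := C).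
by apply/eqP => /(congr1 (fun f : Lip => f x0))/eqP; rewrite oner_eq0.
Qed.

HB.instance Definition _ := GRing.PzSemiRing_isNonZero.Build Lip Lip_oner_neq0.

Fact Lip_scalerAl (k : R[i]) (f g : Lip) : k *: (f * g) = k *: f * g.
Proof. by apply/val_inj/funext => x /=; exact: mulrA. Qed.

HB.instance Definition _ := GRing.Lmodule_isLalgebra.Build R[i] Lip Lip_scalerAl.

Fact Lip_scalerAr (k : R[i]) (f g : Lip) : k *: (f * g) = f * (k *: g).
Proof. by apply/val_inj/funext => x /=; exact: mulrCA. Qed.

HB.instance Definition _ := GRing.Lalgebra_isAlgebra.Build R[i] Lip Lip_scalerAr.

Fact lipschitz_conj (f : Lip) : (fun x => (f x)^*) \in lipschitz_fun.
Proof.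
have /asboolP[k fk] := Lip_proof f; apply/asboolP; exists k => x y.
by rewrite -rmorphB norm_conjC.
Qed.

Definition Lip_star (f : Lip) : Lip := MkLip (lipschitz_conj f).

Fact Lip_starD : {morph Lip_star : f g / f + g}.
Proof. by move=> f g; apply/val_inj/funext => x; exact: rmorphD. Qed.

Fact Lip_starZ (k : R[i]) (f : Lip) : Lip_star (k *: f) = k^* *: Lip_star f.
Proof. by apply/val_inj/funext => x; exact: rmorphM. Qed.

Fact Lip_starM (f g : Lip) : Lip_star (f * g) = Lip_star g * Lip_star f.
Proof. by apply/val_inj/funext => x; rewrite mulrC; exact: rmorphM. Qed.

Fact Lip_starK : involutive Lip_star.
Proof. by move=> f; apply/val_inj/funext => x; exact: conjCK. Qed.

HB.instance Definition _ :=
  isStarAlgebra.Build R[i] Lip Lip_starD Lip_starZ Lip_starM Lip_starK.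

End lipschitz_algebra.

Section michon_triple.
Variables (R : realType) (C : ultrametricCantorType R).

Definition diam (A : set C) : R := sup [set mdist x y | x in A & y in A].

(* The vertices of the reduced Michon tree are the distinct open balls; a vertex
   [v : vertex] is its own clopen set [val v]. *)
Definition vertices : set (set C) :=
  [set A | exists x : C, exists2 e : R, 0 < e & A = [set y | mdist x y < e]].

Definition vertex : choiceType := set_type vertices.

(* tau v = (tau_+ v, tau_- v) *)
Record choice_function := ChoiceFunction {
  choice_pair :> vertex -> C * C ;
  choice_plus_in : forall v, val v (choice_pair v).1 ;
  choice_minus_in : forall v, val v (choice_pair v).2 ;
  choice_diam : forall v,
    mdist (choice_pair v).1 (choice_pair v).2 = diam (val v)
}.

(* D psi v = (diam v)^-1 *: (sigma_1 *m psi v); the domain of this graph consists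
   of all [psi] for which the right-hand side is square-summable. *)
Definition michon_dirac : set (l2 R vertex * l2 R vertex) :=
  [set p : l2 R vertex * l2 R vertex | forall v : vertex,
    p.2 v = ((diam (val v))^-1)%:C *: (sigma1 R *m p.1 v)].

Fact Lip_comp_bounded (f : Lip C) (s : vertex -> C) :
  bounded_family (fun v => f (s v)).
Proof.
by have [k fk] := lipschitz_bounded (Lip_proof f); exists k => v; exact: fk.
Qed.

(* (pi_tau f psi) v = diag (f (tau_+ v), f (tau_- v)) *m psi v *)
Definition michon_rep (tau : choice_function) (f : Lip C) : l2 R vertex -> l2 R vertex :=
  diag_op (Lip_comp_bounded f (fun v => (tau v).1))
          (Lip_comp_bounded f (fun v => (tau v).2)).

End michon_triple.

Arguments michon_dirac {R} C.

(* Main.v *)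
Require Import Defs.
From HB Require Import structures.
From mathcomp Require Import all_boot all_order all_algebra.
From mathcomp Require Import finmap.
From mathcomp Require Import all_classical all_reals all_analysis.
From mathcomp Require Import complex.
From mathcomp Require Import ring lra.

Set Implicit Arguments.
Unset Strict Implicit.
Unset Printing Implicit Defensive.

Import Order.TTheory GRing.Theory Num.Theory Normc numFieldNormedType.Exports.

Local Open Scope classical_set_scope.
Local Open Scope complex_scope.
Local Open Scope ring_scope.

(** The Hilbert space splits into the copies of [C^2] attached to the vertices, and
    every operator of the triple respects this splitting: at [v] the Dirac operator is
    [(diam v)^-1 sigma_1], while the algebra and the grading act by diagonal matrices.
    The algebraic identities are therefore statements about 2 x 2 matrices, and what
    has to be controlled is the size of the blocks as [v] varies.

    The Dirac operator is treated as a special case of [weighted_flip lam], the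
    operator [lam (x) sigma_1] on its maximal domain. It is self-adjoint for
    arbitrary real weights ([weighted_flip_self_adjoint]): it is symmetric, finitely
    supported vectors are dense and lie in its domain, and projecting an element of the
    adjoint onto a single vertex shows that it satisfies the defining equation. Its
    resolvent [(D^2 + 1)^-1] is multiplication by [(1 + lam^2)^-1], and it is compact
    when each bound on [`|lam v|] holds for finitely many [v] only
    ([weighted_flip_compact_resolvent]), since the image of the unit ball then has
    uniformly small tails ([compact_closure_l2]).

    Geometry enters at two points. For the resolvent, a vertex of diameter at least [e]
    is a union of balls of radius [e], finitely many of which cover the compact space,
    so there are finitely many such vertices ([finite_large_vertices]); diameters are
    positive because no point is isolated. For the commutator with [f], the block at
    [v] consists of the numbers [(f (tau_+ v) - f (tau_- v)) / diam v] up to sign. The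
    points [tau_+ v] and [tau_- v] lie at distance [diam v], so these are difference
    quotients of [f], bounded by its Lipschitz constant
    ([lipschitz_difference_quotient]). *)

(** * Bounded functions along an ultrafilter *)

Section ultrafilters.
Variable R : realType.

(** A closed interval is compact, so the image filter has a cluster point there; for
    an ultrafilter, which contains every set or its complement, cluster points are
    limits. *)
Lemma ultra_bounded_cvg (T : Type) (F : set_system T) (c : T -> R) (k : R) :
  UltraFilter F -> (\forall t \near F, `|c t| <= k) -> cvg (c @ F).
Proof.
move=> FU ck.
have [p [_ clp]] : `[- k, k]%classic `&` cluster (c @ F) !=set0.
  apply: (@segment_compact _ (- k) k).
  by near do rewrite /= in_itv /= -ler_norml.
apply/cvg_ex; exists p => B Bp.
have [//|FnB] := in_ultra_setVsetC (c @^-1` B) FU.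
by have [x [/= nBx]] := clp (~` B) B FnB Bp.
Unshelve. all: by end_near. Qed.

End ultrafilters.

(** * Linear algebra in C^2 *)

Section spinors.
Variable R : realType.
Local Notation C2 := 'cV[R[i]]_2.
Implicit Types (z w : C2) (a b c d : R[i]).

Lemma sum_ord2 (T : nmodType) (F : 'I_2 -> T) : \sum_(i < 2) F i = F 0 + F 1.
Proof.
by rewrite !big_ord_recl big_ord0 addr0; congr (_ + F _); exact: val_inj.
Qed.

Lemma diag2E a b z i : (diag2 a b *m z) i 0 = (if i == 0 then a else b) * z i 0.
Proof. by rewrite mul_diag_mx !mxE. Qed.

Lemma sigma1E z i : (sigma1 R *m z) i 0 = z (if i == 0 then 1 else 0) 0.
Proof.
rewrite mxE sum_ord2 !mxE.
by case: i => -[|[|//]] i2 /=; rewrite ?mul0r ?mul1r ?add0r ?addr0.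
Qed.

Lemma spinorP z w : z 0 0 = w 0 0 -> z 1 0 = w 1 0 -> z = w.
Proof.
move=> zw0 zw1; apply/matrixP => i j; rewrite ord1.
have [->//|->//] : i = 0 \/ i = 1.
by case: i => -[|[|//]] ?; [left|right]; exact: val_inj.
Qed.

Lemma sigma1_sigma1 z : sigma1 R *m (sigma1 R *m z) = z.
Proof. by apply: spinorP; rewrite !sigma1E. Qed.

Lemma sigma1_diag2 a b z : sigma1 R *m (diag2 a b *m z) = diag2 b a *m (sigma1 R *m z).
Proof. by apply: spinorP; rewrite !sigma1E !diag2E !sigma1E. Qed.

Lemma diag2_diag2 a b c d z :
  diag2 a b *m (diag2 c d *m z) = diag2 (a * c) (b * d) *m z.
Proof. by apply: spinorP; rewrite !diag2E /= mulrA. Qed.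

Lemma diag2_scalar a z : diag2 a a *m z = a *: z.
Proof. by apply: spinorP; rewrite diag2E !mxE. Qed.

Lemma diag2B a b c d z :
  diag2 a b *m z - diag2 c d *m z = diag2 (a - c) (b - d) *m z.
Proof.
rewrite -mulmxBl; congr (_ *m z); apply/matrixP => i j; rewrite !mxE -mulrnBl.
by case: ifP.
Qed.

Lemma inner2_sigma1 z w : inner2 (sigma1 R *m z) w = inner2 z (sigma1 R *m w).
Proof. by rewrite /inner2 !sum_ord2 !sigma1E /= addrC. Qed.

Lemma inner2_diag2 a b z w :
  inner2 (diag2 a b *m z) w = inner2 z (diag2 a^* b^* *m w).
Proof.
rewrite /inner2; apply: eq_bigr => i _; rewrite !diag2E rmorphM/=; case: ifP => _;
  by rewrite conjCK mulrA (mulrC (z i 0)).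
Qed.

Lemma inner2Z a z w : inner2 (a *: z) w = inner2 z (a^* *: w).
Proof. by rewrite -!diag2_scalar inner2_diag2. Qed.

Lemma conj_realC (x : R) : (x%:C)^* = x%:C.
Proof. exact: conjc_real. Qed.

Lemma sqnorm_sigma1 z : sqnorm (sigma1 R *m z) = sqnorm z.
Proof. by rewrite /sqnorm !sum_ord2 !sigma1E /= addrC. Qed.

Lemma sqnorm_diag2_le (k : R) a b z : `|a| <= k%:C -> `|b| <= k%:C ->
  sqnorm (diag2 a b *m z) <= k ^+ 2 * sqnorm z.
Proof.
move=> ak bk; rewrite /sqnorm mulr_sumr; apply: ler_sum => i _.
rewrite diag2E normcM exprMn ler_wpM2r ?sqr_ge0//.
have {ak bk} : `|if i == 0 then a else b| <= k%:C by case: ifP.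
case: (if _ then _ else _) => x y /=; rewrite lecR => h.
by rewrite lerXn2r ?nnegrE ?sqrtr_ge0// (le_trans _ h) ?sqrtr_ge0.
Qed.

Lemma sqnormZ_real (k : R) z : sqnorm (k%:C *: z) = k ^+ 2 * sqnorm z.
Proof. by rewrite sqnormZ /= expr0n/= addr0 sqr_sqrtr ?sqr_ge0. Qed.

End spinors.

(** * Projections, tails and compactness in l2 *)

Lemma inner_eq0 (R : realType) (H : hilbertType R) (x : H) : inner x x = 0 -> x = 0.
Proof. by rewrite innerE => /eqP; rewrite sqrf_eq0 normr_eq0 => /eqP. Qed.

Section square_summable_sequences.
Variables (R : realType) (V : choiceType).
Local Notation C2 := 'cV[R[i]]_2.
Local Notation l2 := (l2 R V).
Local Notation Re := complex.Re.
Local Notation Im := complex.Im.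
Implicit Types (f g h : l2) (X : set V).

Lemma square_summable_dominated f (g : V -> C2) (k : R) :
  (forall v, sqnorm (g v) <= k * sqnorm (f v)) -> g \in @square_summable R V.
Proof.
move=> gf; apply/square_summableP.
apply: (usummable_le (g := fun v => k * sqnorm (f v))).
  by move=> v; rewrite ger0_norm ?sqnorm_ge0.
exact/usummableZ/l2_sqnorm_summable.
Qed.

Lemma l2_sqnormE f : (l2_sqnorm f)%:E = (\esum_(v in [set: V]) (sqnorm (f v))%:E)%E.
Proof.
rewrite fineK// esum_real_fin//; last exact: l2_sqnorm_summable.
by move=> v; exact: sqnorm_ge0.
Qed.

Lemma l2_sqnorm_dominated f g (k : R) : 0 <= k ->
  (forall v, sqnorm (g v) <= k * sqnorm (f v)) -> l2_sqnorm g <= k * l2_sqnorm f.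
Proof.
move=> k0 gf; rewrite -lee_fin EFinM !l2_sqnormE.
rewrite -esum_realZ//; last by move=> v; exact: sqnorm_ge0.
by apply: le_esum => v _; rewrite lee_fin.
Qed.

Lemma l2_norm_dominated f g (k : R) : 0 <= k ->
  (forall v, sqnorm (g v) <= k ^+ 2 * sqnorm (f v)) -> `|g| <= k%:C * `|f|.
Proof.
move=> k0 gf; rewrite !l2_normE -rmorphM lecR.
rewrite -[X in X * _](ger0_norm k0) -sqrtr_sqr -sqrtrM ?sqr_ge0//.
exact/ler_wsqrtr/l2_sqnorm_dominated/gf/sqr_ge0.
Qed.

Lemma l2_sqnormD_le f g : l2_sqnorm (f + g) <= 2 * (l2_sqnorm f + l2_sqnorm g).
Proof.
rewrite -lee_fin EFinM (EFinD (l2_sqnorm f)) !l2_sqnormE.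
have s0 h (v : V) : [set: V] v -> (0 <= (sqnorm (h v))%:E)%E.
  by move=> _; rewrite lee_fin sqnorm_ge0.
rewrite -(esumD (s0 f) (s0 g)) -esum_realZ//; last first.
  by move=> v; rewrite addr_ge0 ?sqnorm_ge0.
by apply: le_esum => v _; rewrite lee_fin sqnormD.
Qed.

Lemma sqnormN (z : C2) : sqnorm (- z) = sqnorm z.
Proof. by apply: eq_bigr => i _; rewrite !mxE; case: (z i 0) => a b /=; rewrite !sqrrN. Qed.

Lemma l2_sqnormN f : l2_sqnorm (- f) = l2_sqnorm f.
Proof. by congr fine; apply: eq_esum => v _; rewrite /= sqnormN. Qed.

Lemma l2_restrict_subproof X f :
  (fun v => (v \in X)%:R *: f v) \in @square_summable R V.
Proof.
apply: (square_summable_dominated (f := f) (k := 1)) => v.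
by case: (v \in X); rewrite ?scale1r ?mul1r// scale0r sqnormE big1 ?sqnorm_ge0// => i _;
  rewrite mxE /= expr0n /= addr0.
Qed.

(** Orthogonal projection onto the families supported in [X]. *)
Definition l2_restrict X f : l2 := L2 (l2_restrict_subproof X f).

Lemma l2_restrictD X f g : l2_restrict X (f + g) = l2_restrict X f + l2_restrict X g.
Proof. by apply/val_inj/funext => v /=; rewrite scalerDr. Qed.

Lemma l2_restrictN X f : l2_restrict X (- f) = - l2_restrict X f.
Proof. by apply/val_inj/funext => v /=; rewrite scalerN. Qed.

Lemma sqnorm_restrict X f v : sqnorm (l2_restrict X f v) = (v \in X)%:R * sqnorm (f v).
Proof.
rewrite sqnormZ; case: (v \in X) => /=;
  by rewrite ?expr0n ?expr1n/= ?addr0 ?sqrtr0 ?sqrtr1 ?expr0n ?expr1n.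
Qed.

Lemma l2_sqnorm_restrict X f :
  (l2_sqnorm (l2_restrict X f))%:E = (\esum_(v in X) (sqnorm (f v))%:E)%E.
Proof.
rewrite l2_sqnormE [RHS]esum_mkcond; apply: eq_esum => v _.
by rewrite sqnorm_restrict; case: ifP; rewrite ?mul1r ?mul0r.
Qed.

Lemma l2_sqnorm_restrict_le X f : l2_sqnorm (l2_restrict X f) <= l2_sqnorm f.
Proof.
rewrite -[leRHS]mul1r l2_sqnorm_dominated// => v; rewrite sqnorm_restrict.
by rewrite ler_wpM2r ?sqnorm_ge0// lern1 leq_b1.
Qed.

Lemma l2_sqnorm_split X f : finite_set X ->
  l2_sqnorm f = \sum_(v <- fset_set X) sqnorm (f v)
              + l2_sqnorm (l2_restrict (~` X) f).
Proof.
move=> finX; apply: EFin_inj.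
rewrite EFinD [X in _ = (_ + X)%E]l2_sqnorm_restrict [LHS]l2_sqnormE (esumID X)/=; last first.
  by move=> v _; rewrite lee_fin sqnorm_ge0.
rewrite !setTI; congr (_ + _)%E.
rewrite esum_fset//; last by move=> v _; rewrite lee_fin sqnorm_ge0.
by rewrite fsbig_finite//= sumEFin.
Qed.

Lemma l2_inner_adjoint f f' g g' :
  (forall v, inner2 (f' v) (g v) = inner2 (f v) (g' v)) ->
  inner f' g = inner f g'.
Proof. by move=> fg; congr csum; apply/funext. Qed.

Lemma l2_inner_restrict X f g :
  inner (l2_restrict X f) g = inner f (l2_restrict X g).
Proof. by apply: l2_inner_adjoint => v; rewrite /= inner2Z rmorph_nat. Qed.

Lemma l2_tail f (e : R) : 0 < e ->
  exists2 X, finite_set X & l2_sqnorm (l2_restrict (~` X) f) < e.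
Proof.
move=> e0.
have fin_f : (\esum_(v in [set: V]) (sqnorm (f v))%:E)%E \is a fin_num.
  by rewrite -(l2_sqnormE f).
have [_ [X [finX _] <-]] := ub_ereal_sup_adherent e0 fin_f.
rewrite fsbig_finite//= sumEFin -/(esum _ _) -(l2_sqnormE f).
rewrite (l2_sqnorm_split f finX) -EFinB lte_fin => h.
by exists X => //; lra.
Qed.

(** The classical compactness criterion in l2: boundedness plus uniformly small
    tails. Along an ultrafilter on the closure every coordinate is bounded, hence
    converges; the finitely many coordinates in [X] therefore become Cauchy, and the
    tails outside [X] are uniformly small, so the ultrafilter is Cauchy. *)
Lemma compact_closure_l2 (A : set l2) (M : R) :
  (forall f, A f -> l2_sqnorm f <= M) ->
  (forall e : R, 0 < e -> exists2 X, finite_set X &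
    forall f, A f -> l2_sqnorm (l2_restrict (~` X) f) <= e) ->
  compact (closure A).
Proof.
move=> AM Atail; rewrite compact_ultra => F FU FA.
have closeA f (d : R) : 0 < d -> closure A f -> exists2 a, A a & l2_sqnorm (f - a) < d.
  move=> d0 /(_ (ball f (Num.sqrt d)%:C))[|a [Aa]].
    by apply: nbhsx_ballx; rewrite ltcR sqrtr_gt0.
  rewrite -ball_normE /= l2_norm_lt ?sqrtr_gt0// sqr_sqrtr ?ltW// => fa.
  by exists a.
(* Each use of [l2_sqnormD_le] with two equal bounds costs a factor 4: a tail bound
   [e ^+ 2 / 32] on [A] becomes [e ^+ 2 / 8] on its closure and [e ^+ 2 / 2] on
   differences, which leaves [e ^+ 2 / 2] for the coordinates in [X]. *)
have closeS f : closure A f -> l2_sqnorm f <= 2 * (M + 1).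
  move=> /(closeA f 1 ltr01)[a Aa fa]; rewrite -[f](subrK a).
  by rewrite (le_trans (l2_sqnormD_le _ _))// ler_pM2l// addrC lerD ?AM ?ltW.
suff : cauchy F.
  move=> /cauchy_cvg cF; exists (lim F); split=> //.
  by apply: closed_cvg cF => //; exact: closed_closure.
have coord_cvg (c : l2 -> R) : (forall f, c f ^+ 2 <= l2_sqnorm f) -> cvg (c @ F).
  move=> cS; apply: (ultra_bounded_cvg (k := Num.sqrt (2 * (M + 1)))) => //.
  apply: filterS FA => f /closeS fM; rewrite -sqrtr_sqr ler_wsqrtr//.
  exact: le_trans (cS f) fM.
have diff_cvg (c : l2 -> R) : (forall f, c f ^+ 2 <= l2_sqnorm f) ->
    (c p.1 - c p.2) ^+ 2 @[p --> (F, F)] --> 0.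
  move=> /coord_cvg cF; set l := lim (c @ F) in cF.
  have c0 : c p.1 - c p.2 @[p --> (F, F)] --> l - l.
    by apply: cvgB; apply: cvg_comp cF; [exact: cvg_fst|exact: cvg_snd].
  rewrite -(mulr0 0) -[X in X * _](subrr l) -[X in _ * X](subrr l).
  exact: cvgM.
have coord_le f v i : Re (f v i 0) ^+ 2 <= l2_sqnorm f /\
    Im (f v i 0) ^+ 2 <= l2_sqnorm f.
  have : Re (f v i 0) ^+ 2 + Im (f v i 0) ^+ 2 <= l2_sqnorm f.
    apply: le_trans (le_l2_sqnorm f v); rewrite sqnormE (bigD1 i)//= lerDl.
    by apply: sumr_ge0 => j _; rewrite addr_ge0 ?sqr_ge0.
  have := sqr_ge0 (Re (f v i 0)); have := sqr_ge0 (Im (f v i 0)).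
  by move=> *; split; lra.
have sum_cvg (I : Type) (r : seq I) (h : I -> l2 * l2 -> R) (a : I -> R) :
    (forall i, h i p @[p --> (F, F)] --> a i) ->
    \sum_(i <- r) h i p @[p --> (F, F)] --> \sum_(i <- r) a i.
  by move=> ha; apply: cvg_big => // -[x y]; exact: add_continuous.
apply/cauchy_ballP => e.
(* The radii of balls are complex numbers; the positive ones are real. *)
case: e => e e'; rewrite ltcE /= => /andP[/eqP -> e0]; rewrite -[e +i* 0]/(e%:C).
have d0 : 0 < e ^+ 2 / 32 by rewrite divr_gt0 ?exprn_gt0.
have [X finX XA] := Atail _ d0.
have tail f : closure A f -> l2_sqnorm (l2_restrict (~` X) f) <= e ^+ 2 / 8.
  move=> /(closeA f _ d0)[a Aa fa]; rewrite -[f](subrK a).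
  rewrite [leRHS](_ : _ = 2 * (e ^+ 2 / 32 + e ^+ 2 / 32)); last by field.
  rewrite l2_restrictD (le_trans (l2_sqnormD_le _ _))// ler_pM2l// lerD ?(XA a)//.
  by rewrite ltW// (le_lt_trans _ fa)// l2_sqnorm_restrict_le.
have head_cvg : \sum_(v <- fset_set X) sqnorm ((p.1 : l2) v - (p.2 : l2) v)
    @[p --> (F, F)] -->
    \sum_(v <- fset_set X) \sum_(i < 2) (0 + 0 : R).
  apply: (sum_cvg) => v; under eq_cvg do rewrite sqnormB.
  apply: (sum_cvg) => i; apply: cvgD.
    by apply: (diff_cvg (fun f => Re (f v i 0))) => f; have [] := coord_le f v i.
  by apply: (diff_cvg (fun f => Im (f v i 0))) => f; have [] := coord_le f v i.
have head : \forall p \near (F, F),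
    \sum_(v <- fset_set X) sqnorm ((p.1 : l2) v - (p.2 : l2) v) < e ^+ 2 / 2.
  apply: (cvgr_lt _ head_cvg); rewrite big1 ?divr_gt0 ?exprn_gt0// => v _.
  by rewrite big1// addr0.
have : \forall p \near (F, F), closure A p.1 /\ closure A p.2.
  by exists (closure A, closure A) => // p [].
apply: filterS2 head => -[f g] /= headfg [cf cg].
rewrite -ball_normE /= l2_norm_lt// (l2_sqnorm_split _ finX).
have : l2_sqnorm (l2_restrict (~` X) (f - g)) <= e ^+ 2 / 2.
  rewrite [leRHS](_ : _ = 2 * (e ^+ 2 / 8 + e ^+ 2 / 8)); last by field.
  rewrite l2_restrictD (le_trans (l2_sqnormD_le _ _))// ler_pM2l// lerD ?(tail f)//.
  by rewrite l2_restrictN l2_sqnormN tail.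
rewrite [ltRHS](_ : _ = e ^+ 2 / 2 + e ^+ 2 / 2); last by field.
exact: ltr_leD.
Qed.

End square_summable_sequences.

(** * The operator with blocks lam v sigma_1 *)

Section weighted_flip.
Variables (R : realType) (V : choiceType) (lam : V -> R).
Local Notation l2 := (l2 R V).
Implicit Types (f g h : l2) (X : set V).

(** The operator [lam (x) sigma_1] on its maximal domain, for any real weights; the
    Dirac operator of the Michon tree is the case [lam v = (diam v)^-1]. *)
Definition weighted_flip : set (l2 * l2) :=
  [set p : l2 * l2 | forall v, p.2 v = (lam v)%:C *: (sigma1 R *m p.1 v)].

Lemma weighted_flip_symmetric p q : weighted_flip p -> weighted_flip q ->
  inner p.2 q.1 = inner p.1 q.2.
Proof.
move=> Dp Dq; apply: l2_inner_adjoint => v.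
by rewrite Dp Dq inner2Z inner2_sigma1 conj_realC -scalemxAr.
Qed.

Lemma weighted_flip_restrict X f g : weighted_flip (f, g) ->
  weighted_flip (l2_restrict X f, l2_restrict X g).
Proof. by move=> Dfg v /=; rewrite Dfg/= -scalemxAr !scalerA mulrC. Qed.

(** The weights are bounded on [X], so cutting any vector off outside [X] puts it into
    the domain, even if the weights are unbounded on the whole of [V]. *)
Lemma weighted_flip_finite_dom X f : finite_set X ->
  op_dom weighted_flip (l2_restrict X f).
Proof.
move=> finX; pose M := \sum_(v <- fset_set X) lam v ^+ 2.
have gP : (fun v => (lam v)%:C *: (sigma1 R *m l2_restrict X f v))
    \in @square_summable R V.
  apply: (square_summable_dominated (f := f) (k := M)) => v.
  rewrite sqnormZ_real sqnorm_sigma1 sqnorm_restrict.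
  have M0 : 0 <= M by apply: sumr_ge0 => w _; exact: sqr_ge0.
  have [vX|vX] := boolP (v \in X); last by rewrite mul0r mulr0 mulr_ge0 ?sqnorm_ge0.
  rewrite mul1r ler_wpM2r ?sqnorm_ge0// /M (bigD1_seq v) ?fset_uniq//=; last first.
    by rewrite in_fset_set.
  by rewrite lerDl sumr_ge0// => w _; exact: sqr_ge0.
by exists (L2 gP).
Qed.

Lemma weighted_flip_linear : linear_operator weighted_flip.
Proof.
split=> [f g h Dfg Dfh||k [f g] [f' g'] Dfg Dfg' v] /=.
- by apply/val_inj/funext => v; rewrite [LHS]Dfg [RHS]Dfh.
- by move=> v /=; rewrite mulmx0 scaler0.
- change (k *: g v + g' v =
    (lam v)%:C *: (sigma1 R *m (k *: f v + f' v))).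
  rewrite (Dfg v : g v = _) (Dfg' v : g' v = _) /= mulmxDr -scalemxAr scalerDr !scalerA.
  by rewrite [k * _]mulrC.
Qed.

Lemma weighted_flip_dense : dense (op_dom weighted_flip).
Proof.
move=> O [f Of] oO; have [e /= e0 feO] := (nbhs_ballP f O).1 (open_nbhs_nbhs (conj oO Of)).
(* The radii of balls are complex numbers; the positive ones are real. *)
case: e e0 feO => e e'; rewrite ltcE /= => /andP[/eqP -> e0].
rewrite -[e +i* 0]/(e%:C) => feO.
have [X finX fX] := l2_tail f (exprn_gt0 2 e0).
exists (l2_restrict X f); split; last exact: weighted_flip_finite_dom.
apply: feO; rewrite -ball_normE /= l2_norm_lt//.
rewrite (_ : f - _ = l2_restrict (~` X) f)//; apply/val_inj/funext => v.
change (f v - (v \in X)%:R *: f v = (v \in ~` X)%:R *: f v).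
by rewrite in_setC; case: (v \in X); rewrite /= ?scale1r ?scale0r ?subrr ?subr0.
Qed.

(** Symmetry is pointwise. Conversely, let [(x, y)] be in the adjoint and let [P] be
    the projection onto the vertex [v]. Then [P x] lies in the domain, and moving [P]
    and the operator across the inner product shows that [P y] and the image [z] of
    [P x] have the same inner product with every vector [P u]. Hence they agree at
    [v], which is the defining equation there. *)
Lemma weighted_flip_self_adjoint : self_adjoint weighted_flip.
Proof.
split; [exact: weighted_flip_linear|exact: weighted_flip_dense|].
apply/seteqP; split=> [[x y] adj v|p Dp q Dq]; last exact: weighted_flip_symmetric.
pose P : l2 -> l2 := l2_restrict [set v].
have [z Dz] : op_dom weighted_flip (P x) by exact: weighted_flip_finite_dom.
pose u := P (P y) - P z.
have [w Dw] : op_dom weighted_flip (P u) by exact: weighted_flip_finite_dom.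
(* The second [P], now on [w], is the one that moves across to [x]: of [x] itself it
   is not known that it lies in the domain, of [P x] it is. *)
have := adj _ (weighted_flip_restrict [set v] Dw).
rewrite /= -!/P !l2_inner_restrict (weighted_flip_symmetric Dw Dz) /= l2_inner_restrict.
move=> uPz; have u0 : u = 0 by apply: inner_eq0; rewrite linearBr/= uPz subrr.
have Pv f : P f v = f v by rewrite /= mem_set// scale1r.
have /(congr1 (fun f : l2 => f v)) : P (P y) = P z by apply/eqP; rewrite -subr_eq0 -/u u0.
by rewrite !Pv => ->; rewrite (Dz v : z v = _) /= mem_set// scale1r.
Qed.

Let resolvent_coef v : R := (1 + lam v ^+ 2)^-1.

Let resolvent_coefK v : (1 + lam v ^+ 2) * resolvent_coef v = 1.
Proof. by rewrite mulfV// lt0r_neq0// ltr_pwDl// sqr_ge0. Qed.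

Let resolvent_coef_ge0 v : 0 <= resolvent_coef v.
Proof. by rewrite invr_ge0 addr_ge0 ?sqr_ge0. Qed.

Let resolvent_coef_le1 v : resolvent_coef v <= 1.
Proof. by rewrite invf_le1 ?lerDl ?sqr_ge0// ltr_pwDl// sqr_ge0. Qed.

Fact weighted_flip_resolvent_subproof f :
  (fun v => (resolvent_coef v)%:C *: f v) \in @square_summable R V.
Proof.
apply: (square_summable_dominated (f := f) (k := 1)) => v.
by rewrite sqnormZ_real ler_wpM2r ?sqnorm_ge0// exprn_ile1.
Qed.

Definition weighted_flip_resolvent f : l2 := L2 (weighted_flip_resolvent_subproof f).

(** As [sigma_1] squares to 1, [D^2 + 1] is multiplication by [lam v ^+ 2 + 1]. The
    inverse is everywhere defined because [lam v / (1 + lam v ^+ 2)] is bounded by 1,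
    which puts its values in the domain of [D^2]. *)
Lemma weighted_flip_resolventE :
  op_inv (op_add (op_comp weighted_flip weighted_flip) (op_graph id)) =
  op_graph weighted_flip_resolvent.
Proof.
apply/seteqP; split=> [[f g] [y [z [[u Du Dy] zg fE]]]|[f g] gE].
  apply/val_inj/funext => v /=.
  have -> : f v = y v + g v by rewrite (fE : f = y + z) (zg : z = g).
  rewrite (Dy v : y v = _) (Du v : u v = _) /= -scalemxAr sigma1_sigma1.
  rewrite scalerA -{3}[g v]scale1r -scalerDl scalerA.
  rewrite (_ : _ * _ = 1) ?scale1r// -[1]/(1%:C) -rmorphM -rmorphD -rmorphM/=.
  by congr (_%:C); have := resolvent_coefK v; lra.
rewrite (gE : g = weighted_flip_resolvent f) {g gE}.
have uP : (fun v => (lam v)%:C *: (sigma1 R *m weighted_flip_resolvent f v))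
    \in @square_summable R V.
  apply: (square_summable_dominated (f := f) (k := 1)) => v /=.
  rewrite sqnormZ_real sqnorm_sigma1 sqnormZ_real mulrA ler_wpM2r ?sqnorm_ge0//.
  have := resolvent_coefK v; have := resolvent_coef_le1 v.
  have := resolvent_coef_ge0 v; have := sqr_ge0 (lam v); nra.
exists (f - weighted_flip_resolvent f), (weighted_flip_resolvent f); split => //=.
  exists (L2 uP) => // v.
  change (f v - (resolvent_coef v)%:C *: f v = (lam v)%:C *:
    (sigma1 R *m ((lam v)%:C *: (sigma1 R *m ((resolvent_coef v)%:C *: f v))))).
  rewrite -scalemxAr sigma1_sigma1 !scalerA -{1}[f v]scale1r -scalerBl.
  rewrite -[1]/(1%:C) -!rmorphM -rmorphB/=.
  by congr (_%:C *: _); have := resolvent_coefK v; lra.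
by rewrite subrK.
Qed.

(** The resolvent multiplies by [(1 + lam v ^+ 2)^-1], which is at most [e] outside the
    finite set where [`|lam v|] is at most the square root of [e^-1]: the image of the
    unit ball has uniformly small tails. *)
Lemma weighted_flip_compact_resolvent :
  (forall M : R, finite_set [set v | `|lam v| <= M]) ->
  compact_operator (op_inv (op_add (op_comp weighted_flip weighted_flip) (op_graph id))).
Proof.
move=> fin_lam; exists weighted_flip_resolvent; split.
- move=> k f g; apply/val_inj/funext => v.
  change ((resolvent_coef v)%:C *: (k *: f v + g v) =
    k *: ((resolvent_coef v)%:C *: f v) + (resolvent_coef v)%:C *: g v).
  by rewrite scalerDr !scalerA [k * _]mulrC.
- exact: weighted_flip_resolventE.
have ball1 f : `|f| <= 1 -> l2_sqnorm f <= 1.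
  rewrite l2_normE -[1]/(1%:C) lecR => f1.
  by rewrite -[leLHS]sqr_sqrtr ?l2_sqnorm_ge0// exprn_ile1// sqrtr_ge0.
apply: (@compact_closure_l2 _ _ _ 1) => [_ [f /ball1 f1 <-]|e e0].
  apply: le_trans f1; rewrite -[leRHS]mul1r l2_sqnorm_dominated// => v /=.
  by rewrite sqnormZ_real ler_wpM2r ?sqnorm_ge0// exprn_ile1.
exists [set v | `|lam v| <= Num.sqrt e^-1] => // _ [f /ball1 f1 <-].
rewrite (@le_trans _ _ (e * l2_sqnorm f))//; last by rewrite ler_piMr// ltW.
apply: l2_sqnorm_dominated => [|v]; first exact: ltW.
rewrite sqnorm_restrict; have [/set_mem/= /negP|_] := boolP (_ \in _); last first.
  by rewrite mul0r mulr_ge0 ?sqnorm_ge0// ltW.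
rewrite mul1r -ltNge => h; have {h} : e^-1 < lam v ^+ 2.
  rewrite -[e^-1]sqr_sqrtr ?invr_ge0 1?ltW// -[ltRHS]real_normK ?num_real//.
  by rewrite ltr_sqr ?nnegrE ?sqrtr_ge0.
move=> h.
rewrite [X in sqnorm X]/= sqnormZ_real ler_wpM2r ?sqnorm_ge0//.
have {h} : 1 < e * lam v ^+ 2 by rewrite mulrC -ltr_pdivrMr// div1r.
have := resolvent_coefK v; have := resolvent_coef_le1 v.
have := resolvent_coef_ge0 v; nra.
Qed.

End weighted_flip.

(** * Block-diagonal operators and their commutators *)

Section diagonal_operators.
Variables (R : realType) (V : choiceType).
Local Notation l2 := (l2 R V).
Variables (a b : V -> R[i]) (ha : bounded_family a) (hb : bounded_family b).

Lemma diag_op_bounded : bounded_operator (diag_op ha hb).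
Proof.
split=> [k f g|].
  by apply/val_inj/funext => v; exact: (linearP (mulmx (diag2 (a v) (b v)))).
have [[k ak] [l bl]] := (ha, hb).
exists (`|k| + `|l|) => -[f g] gE; rewrite (gE : g = diag_op ha hb f) /=.
apply: l2_norm_dominated => [|v]; first exact: addr_ge0.
apply: sqnorm_diag2_le.
  by rewrite (le_trans (ak v))// lecR (le_trans (ler_norm k))// lerDl.
by rewrite (le_trans (bl v))// lecR (le_trans (ler_norm l))// lerDr.
Qed.

Lemma weighted_flip_diag_op (lam : V -> R) f g : weighted_flip lam (f, g) ->
  weighted_flip lam (diag_op ha hb f, diag_op hb ha g).
Proof.
move=> Dfg v.
change (diag2 (b v) (a v) *m g v =
  (lam v)%:C *: (sigma1 R *m (diag2 (a v) (b v) *m f v))).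
by rewrite sigma1_diag2 (Dfg v : g v = _) /= -scalemxAr.
Qed.

(** Since [sigma_1] exchanges the two diagonal entries, the commutator is the diagonal
    operator with entries [lam (b - a)] and [lam (a - b)] composed with the unitary
    [sigma_1]. *)
Lemma weighted_flip_bounded_commutator (lam : V -> R) (k : R) :
  (forall v, `|(lam v)%:C * (a v - b v)| <= k%:C) ->
  bounded_commutator (weighted_flip lam) (diag_op ha hb).
Proof.
move=> kab; split=> [f [g Dfg]|].
  by exists (diag_op hb ha g), (diag_op ha hb f) => //; exact: weighted_flip_diag_op.
exists `|k| => -[f g] [y [z [[w wE Dw] [u Du zE] gE]]] /=.
apply: l2_norm_dominated => // v.
have gvE : g v = diag2 ((lam v)%:C * (b v - a v)) ((lam v)%:C * (a v - b v))
    *m (sigma1 R *m f v).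
  have -> : g v = y v - (- z) v.
    by rewrite (gE : g = y + z); change (y v + z v = y v - - z v); rewrite opprK.
  rewrite (zE : - z = diag_op ha hb u) (Dw v : y v = _) /= (wE : w = diag_op ha hb f).
  change ((lam v)%:C *: (sigma1 R *m (diag2 (a v) (b v) *m f v)) -
    diag2 (a v) (b v) *m u v = diag2 ((lam v)%:C * (b v - a v))
    ((lam v)%:C * (a v - b v)) *m (sigma1 R *m f v)).
  rewrite (Du v : u v = _) /= sigma1_diag2 -!diag2_scalar !diag2_diag2 diag2B.
  by congr (diag2 _ _ *m _); ring.
have kC : `|(lam v)%:C * (a v - b v)| <= `|k|%:C.
  by rewrite (le_trans (kab v))// lecR ler_norm.
change (sqnorm (g v) <= `|k| ^+ 2 * sqnorm (f v)).
rewrite -[X in _ * X]sqnorm_sigma1 gvE sqnorm_diag2_le// -normrN.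
by rewrite -mulrN opprB.
Qed.

End diagonal_operators.

(** * The grading *)

Section grading.
Variables (R : realType) (V : choiceType).

Lemma grading_adjoint : op_adjoint (op_graph (grading R V)) = op_graph (grading R V).
Proof.
have sym f g : inner (grading R V f) g = inner f (grading R V g).
  apply: l2_inner_adjoint => v.
  change (inner2 (diag2 1 (-1) *m f v) (g v) = inner2 (f v) (diag2 1 (-1) *m g v)).
  by rewrite inner2_diag2 rmorphN !rmorph1.
apply/seteqP; split=> [[f g] adj|[f g] gE [h1 h2] hE] /=.
  pose u := grading R V f - g.
  have := adj (u, grading R V u) erefl.
  rewrite /= sym => uE; apply/esym/eqP; rewrite -subr_eq0; apply/eqP/inner_eq0.
  by rewrite linearBr/= -/u uE subrr.
by rewrite (hE : h2 = grading R V h1) (gE : g = grading R V f) sym.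
Qed.

Lemma gradingK : grading R V \o grading R V = id.
Proof.
apply/funext => f; apply/val_inj/funext => v.
rewrite -[RHS]scale1r -diag2_scalar; apply: etrans (diag2_diag2 _ _ _ _ _) _.
by rewrite mulrNN mulr1.
Qed.

(** Exchanging the diagonal entries of [sigma_3] negates it, so [weighted_flip_diag_op]
    with the entries 1 and -1 is anticommutation. *)
Lemma weighted_flip_grading (lam : V -> R) :
  op_comp (op_graph (grading R V)) (weighted_flip lam) =
  op_opp (op_comp (weighted_flip lam) (op_graph (grading R V))).
Proof.
have anti f g : weighted_flip lam (f, g) ->
    weighted_flip lam (grading R V f, - grading R V g).
  move=> Dfg v; have := weighted_flip_diag_op (bounded_family_cst V 1)
    (bounded_family_cst V (-1)) Dfg v.
  rewrite /= => <-.
  change (- (diag2 1 (-1) *m g v) = diag2 (-1) 1 *m g v).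
  rewrite -mulNmx; congr (_ *m _); apply/matrixP => i j; rewrite !mxE.
  by rewrite -mulNrn; case: ifP; rewrite ?opprK.
have gradK f : grading R V (grading R V f) = f := congr1 (@^~ f) gradingK.
have gradN f : grading R V (- f) = - grading R V f.
  by apply/val_inj/funext => v; exact: mulmxN.
apply/seteqP; split=> [[f h] [g Dfg hE]|[f h] [u uE Duh]].
  exists (grading R V f) => //=; rewrite (hE : h = grading R V g).
  exact: anti.
rewrite (uE : u = grading R V f) in Duh.
exists (- grading R V (- h)); first by rewrite -[f]gradK; exact: anti.
by rewrite /op_graph /mkset /= -gradN opprK gradK.
Qed.

End grading.

(** * Diameters of the vertices of the Michon tree *)

Section michon_tree.
Variables (R : realType) (C : ultrametricCantorType R).

(** A finite cover by [e]-balls, from the near-covering form of compactness applied to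
    the filter of all sufficiently large finite sets of centres. *)
Lemma totally_bounded_cantor (e : R) : 0 < e ->
  exists S : {fset C}, forall y : C, exists2 z, z \in S & mdist z y < e.
Proof.
move=> e0; pose F := filter_from [set: {fset C}] (fun S0 => [set S | (S0 `<=` S)%fset]).
have FF : Filter F.
  apply: filter_from_filter; first by exists fset0.
  move=> S T _ _; exists (S `|` T)%fset => // U /=; rewrite fsubUset.
  by move=> /andP[].
have [x _|S _ yS] := (compact_near_coveringP [set: C]).1 cantor_compact _ F
    (fun S y => exists2 z, z \in S & mdist z y < e) FF; last first.
  by exists S => y; apply: (yS S) => //=; exact: fsubset_refl.
exists (ball x e, [set S : {fset C} | x \in S]).
  split; first exact: nbhsx_ballx.
  by exists [fset x]%fset => // S /=; rewrite fsub1set.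
by move=> [y S] [/=]; rewrite ballEmdist/= => xy xS; exists x.
Qed.

(** In an ultrametric space the diameter of a ball is at most its radius, not just
    twice its radius. The upper bound is recorded too, as [sup] of an unbounded set is
    a default value. *)
Lemma vertex_diam_le (v : vertex C) (x : C) (e : R) : 0 < e ->
  val v = [set y | mdist x y < e] -> diam (val v) <= e /\
  has_ubound [set mdist x y | x in val v & y in val v].
Proof.
move=> e0 vE.
have vP y : val v y <-> mdist x y < e by rewrite vE.
have ub : ubound [set mdist x y | x in val v & y in val v] e.
  move=> _ [y /vP xy [z /vP xz <-]].
  by rewrite ltW// (le_lt_trans (mdist_ultra y z x))// gt_max metric_sym xy.
split; last by exists e.
apply: ge_sup => //; exists (mdist x x), x; first by apply/vP; rewrite mdistxx.
by exists x => //; apply/vP; rewrite mdistxx.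
Qed.

(** Otherwise the ball would be a neighbourhood of its centre containing no other
    point, and the centre would be isolated. *)
Lemma vertex_diam_gt0 (v : vertex C) : 0 < diam (val v).
Proof.
have [x [e e0 vE]] := set_valP v.
have [_ ub] := vertex_diam_le e0 vE.
have vx : val v x by rewrite vE /= mdistxx.
have [y [vy xy]] : exists y, val v y /\ x != y.
  apply: contrapT => nxy.
  suff : isolated [set: C] x by rewrite cantor_no_isolated_point.
  split; first exact: mem_set.
  exists (val v); first by rewrite vE -ballEmdist; exact: nbhsx_ballx.
  rewrite setIT; apply/seteqP; split=> [y vy|_ ->//].
  by apply/esym/eqP; apply: contrapT => /negP xy; apply: nxy; exists y.
rewrite (@lt_le_trans _ _ (mdist x y)) ?mdist_gt0//.
by apply: ub_le_sup => //; exists x => //; exists y.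
Qed.

(** A vertex of diameter at least [e] is a ball of radius at least [e], so by the
    ultrametric inequality it is a union of [e]-balls. Finitely many [e]-balls cover
    the space, and the vertex is determined by which of their centres it contains. *)
Lemma finite_large_vertices (e : R) : 0 < e ->
  finite_set [set v : vertex C | e <= diam (val v)].
Proof.
move=> e0; have [S Se] := totally_bounded_cantor e0.
pose U (B : {fset C}) : set C := [set y | exists2 z, z \in B & mdist z y < e].
have finU : finite_set (U @` [set` fpowerset S]) by exact/finite_image/finite_fset.
apply: sub_finite_set (finite_preimage _ finU); last by move=> v w _ _; exact: val_inj.
move=> v ev.
have [x [r r0 vE]] := set_valP v; have [vr _] := vertex_diam_le r0 vE.
have er : e <= r := le_trans ev vr.
exists [fset z in S | z \in val v]%fset.
  by rewrite /= fpowersetE; apply/fsubsetP => z; rewrite !inE => /andP[].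
have ball_sub y z : mdist z y < e -> val v z -> val v y.
  rewrite vE => zy xz; rewrite /= (le_lt_trans (mdist_ultra x y z))// gt_max xz.
  exact: lt_le_trans er.
apply/seteqP; split=> [y [z]|y vy].
  by rewrite !inE => /andP[_ /set_mem vz] zy; exact: ball_sub zy vz.
have [z zS zy] := Se y; exists z => //.
by rewrite !inE zS; apply/mem_set/(ball_sub z y) => //; rewrite metric_sym.
Qed.

End michon_tree.

(** * The Michon spectral triple *)

Section michon_representation.
Variables (R : realType) (C : ultrametricCantorType R) (tau : choice_function C).

Lemma michon_rep_bounded_representation : bounded_representation (michon_rep tau).
Proof.
split=> [f|k f g x|x|f g x|f x y].
- exact: diag_op_bounded.
- apply/val_inj/funext => v.
  change (diag2 (k * f (tau v).1 + g (tau v).1) (k * f (tau v).2 + g (tau v).2) *m x v =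
    k *: (diag2 (f (tau v).1) (f (tau v).2) *m x v) +
    diag2 (g (tau v).1) (g (tau v).2) *m x v).
  rewrite -(diag2_scalar k) diag2_diag2 -mulmxDl; congr (_ *m _).
  by apply/matrixP => i j; rewrite !mxE -mulrnDl; case: ifP.
- by apply/val_inj/funext => v; exact: etrans (diag2_scalar 1 (x v)) (scale1r _).
- by apply/val_inj/funext => v; exact/esym/diag2_diag2.
- apply: l2_inner_adjoint => v.
  change (inner2 (diag2 (f (tau v).1)^* (f (tau v).2)^* *m x v) (y v) =
    inner2 (x v) (diag2 (f (tau v).1) (f (tau v).2) *m y v)).
  by rewrite inner2_diag2 !conjCK.
Qed.

(** The choice function realizes the diameter, so the weighted difference is a
    difference quotient of [f]. *)
Lemma lipschitz_difference_quotient (f : Lip C) : exists k : R, forall v : vertex C,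
  `|((diam (val v))^-1)%:C * (f (tau v).1 - f (tau v).2)| <= k%:C.
Proof.
have /asboolP[k fk] := Lip_proof f; exists k => v.
have d0 := vertex_diam_gt0 v.
rewrite normrM (_ : `|_%:C| = ((diam (val v))^-1)%:C); last first.
  by rewrite ger0_norm// ler0c invr_ge0 ltW.
rewrite (le_trans (ler_wpM2l _ (fk _ _)))//; first by rewrite ler0c invr_ge0 ltW.
by rewrite choice_diam -rmorphM/= lecR mulrCA mulVf ?mulr1// gt_eqF.
Qed.

(** The weights [(diam v)^-1] stay below a bound only at the vertices of large
    diameter, and these are finite in number: the resolvent is compact. *)
Lemma michon_odd_spectral_triple :
  odd_spectral_triple (michon_rep tau) (michon_dirac C).
Proof.
split.
- exact: michon_rep_bounded_representation.
- exact: weighted_flip_self_adjoint.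
- move=> f; have [k fk] := lipschitz_difference_quotient f.
  exact: weighted_flip_bounded_commutator fk.
apply: weighted_flip_compact_resolvent => M.
have M0 : 0 < `|M| + 1 by rewrite ltr_wpDl.
have M1 : 0 < (`|M| + 1)^-1 by rewrite invr_gt0.
apply: sub_finite_set (finite_large_vertices C M1) => v.
have d0 := vertex_diam_gt0 v.
rewrite /mkset ger0_norm ?invr_ge0 ?(ltW d0)// => vM.
by rewrite invf_ple ?posrE// (le_trans vM)// (le_trans (ler_norm _))// lerDl.
Qed.

End michon_representation.

Theorem proposition8 (R : realType) (C : ultrametricCantorType R)
    (tau : choice_function C) :
  even_spectral_triple (michon_rep tau) (michon_dirac C) (grading R (vertex C)).
Proof.
split; first exact: michon_odd_spectral_triple.
split.
- exact: diag_op_bounded.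
- exact: grading_adjoint.
- exact: gradingK.
- exact: weighted_flip_grading.
move=> f; apply/funext => x; apply/val_inj/funext => v.
change (diag2 1 (-1) *m (diag2 (f (tau v).1) (f (tau v).2) *m x v) =
  diag2 (f (tau v).1) (f (tau v).2) *m (diag2 1 (-1) *m x v)).
by rewrite !diag2_diag2 mul1r mulr1 mulN1r mulrN1.
Qed.
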